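(* If for every constant $c$ there is an output-polynomial time algorithm solving ICS-Enum on implicational bases of degree at most $c$, then there is an output-polynomial time algorithm solving ICS-Enum on arbitrary implicational bases.
   Context: An implicational base $(X,\Sigma)$ is a set of implications $A\to B$ with $A,B\subseteq X$ disjoint; its closed sets are the $C\subseteq X$ with $A\subseteq C\Rightarrow B\subseteq C$ for every $A\to B\in\Sigma$, forming a closure system $\mathcal{C}$. For $x\in X$, $\mathrm{irr}(x)$ is the family of inclusion-maximal closed sets not containing $x$; $\mathrm{irr}(\mathcal{C})=\bigcup_x\mathrm{irr}(x)$. ICS-Enum: given $(X,\Sigma)$, list $\mathrm{irr}(\mathcal{C})$ without repetition. The degree of $\Sigma$ is the maximum over $x\in X$ of the number of implications of $\Sigma$ in which $x$ appears. An algorithm is output-polynomial if its total running time is polynomial in $|X|+|\Sigma|$ plus the number of solutions. *)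

(* Defs.v *)
From mathcomp Require Import all_boot.
Set Implicit Arguments.
Unset Strict Implicit.
Unset Printing Implicit Defensive.

(* An implication A -> B is the pair (A, B). *)
Notation implication X := ({set X} * {set X})%type.

Section ClosureSystem.
Variable X : finType.
Implicit Types (Sigma : {set implication X}) (C : {set X}).

Definition implicational_base Sigma : bool :=
  [forall p in Sigma, [disjoint p.1 & p.2]].

Definition closed_set Sigma C : bool :=
  [forall p in Sigma, (p.1 \subset C) ==> (p.2 \subset C)].

Definition irr_at Sigma (x : X) : {set {set X}} :=
  [set C | maxset [pred D : {set X} | closed_set Sigma D && (x \notin D)] C].

Definition irr Sigma : {set {set X}} := \bigcup_(x : X) irr_at Sigma x.

Definition degree Sigma : nat :=
  \max_(x : X) #|[set p in Sigma | x \in p.1 :|: p.2]|.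

End ClosureSystem.

(* Algorithms are programs of Jones's imperative language WHILE over binary
   trees (N. D. Jones, Computability and Complexity from a Programming
   Perspective, 1997).  Trees are only built, projected and tested against the
   empty tree, so with shared subtrees every operation takes constant time on
   a pointer machine: running times agree with those of Turing machines and
   RAMs up to a polynomial. *)
Inductive tree : Type := Leaf | Node of tree & tree.

Definition left_subtree (t : tree) : tree := if t is Node l _ then l else Leaf.
Definition right_subtree (t : tree) : tree := if t is Node _ r then r else Leaf.
Definition is_node (t : tree) : bool := if t is Node _ _ then true else false.

Inductive expr : Type :=
  | EVar of nat
  | ELeaf
  | ENode of expr & expr
  | ELeft of expr
  | ERight of expr.

Inductive cmd : Type :=
  | Assign of nat & expr
  | Seq of cmd & cmd
  | If of expr & cmd & cmd
  | While of expr & cmd.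

Definition store : Type := nat -> tree.

Definition update (s : store) (x : nat) (t : tree) : store :=
  fun y => if y == x then t else s y.

Fixpoint eval (s : store) (e : expr) : tree :=
  match e with
  | EVar x => s x
  | ELeaf => Leaf
  | ENode e1 e2 => Node (eval s e1) (eval s e2)
  | ELeft e1 => left_subtree (eval s e1)
  | ERight e1 => right_subtree (eval s e1)
  end.

Fixpoint cost (e : expr) : nat :=
  match e with
  | EVar _ | ELeaf => 1
  | ENode e1 e2 => (cost e1 + cost e2).+1
  | ELeft e1 | ERight e1 => (cost e1).+1
  end.

(* exec c s T s': started in store s, the command c halts in store s' after
   T elementary steps. *)
Inductive exec : cmd -> store -> nat -> store -> Prop :=
  | ExecAssign x e s :
      exec (Assign x e) s (cost e).+1 (update s x (eval s e))
  | ExecSeq c1 c2 s T1 s1 T2 s2 :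
      exec c1 s T1 s1 -> exec c2 s1 T2 s2 ->
      exec (Seq c1 c2) s (T1 + T2).+1 s2
  | ExecIfTrue e c1 c2 s T s' :
      is_node (eval s e) -> exec c1 s T s' ->
      exec (If e c1 c2) s (cost e + T).+1 s'
  | ExecIfFalse e c1 c2 s T s' :
      ~~ is_node (eval s e) -> exec c2 s T s' ->
      exec (If e c1 c2) s (cost e + T).+1 s'
  | ExecWhileTrue e c s T1 s1 T2 s2 :
      is_node (eval s e) -> exec c s T1 s1 -> exec (While e c) s1 T2 s2 ->
      exec (While e c) s (cost e + T1 + T2).+1 s2
  | ExecWhileFalse e c s :
      ~~ is_node (eval s e) -> exec (While e c) s (cost e).+1 s.

(* Variable 0 holds the input at the start and the output at the end; all
   other variables start empty. *)
Definition runs (P : cmd) (input : tree) (T : nat) (output : tree) : Prop :=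
  exists2 s : store,
    exec P (update (fun _ => Leaf) 0 input) T s & s 0 = output.

Definition encode_seq (l : seq tree) : tree := foldr Node Leaf l.

Definition encode_bool (b : bool) : tree := if b then Node Leaf Leaf else Leaf.

Definition encode_unary (n : nat) : tree := encode_seq (nseq n Leaf).

Definition encode_set (n : nat) (A : {set 'I_n}) : tree :=
  encode_seq [seq encode_bool (i \in A) | i <- enum 'I_n].

Definition encode_implication (n : nat) (p : implication 'I_n) : tree :=
  Node (encode_set p.1) (encode_set p.2).

(* The ground set is {0, ..., n - 1}; sets are given by their incidence
   vectors, so the input has size polynomial in |X| + |Sigma|. *)
Definition encode_input (n : nat) (l : seq (implication 'I_n)) : tree :=
  Node (encode_unary n) (encode_seq (map (@encode_implication n) l)).

Definition encode_output (n : nat) (l : seq {set 'I_n}) : tree :=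
  encode_seq (map (@encode_set n) l).

(* K is the class of admissible instances: nothing is required of P on the
   others.  The implications may be presented in any order l, and the
   solutions may be listed in any order sol. *)
Definition output_poly_ICS_Enum
    (K : forall n : nat, {set implication 'I_n} -> Prop) (P : cmd) : Prop :=
  exists a k : nat,
  forall (n : nat) (Sigma : {set implication 'I_n})
         (l : seq (implication 'I_n)),
  implicational_base Sigma -> K n Sigma -> uniq l -> l =i Sigma ->
  exists (T : nat) (sol : seq {set 'I_n}),
    [/\ runs P (encode_input l) T (encode_output sol),
        uniq sol,
        sol =i irr Sigma &
        T <= a * (n + #|Sigma| + #|irr Sigma|) ^ k + a].

(* Main.v *)
(* The degree is lowered by replication.  Let m be the number of implications
   over the ground set {0, ..., n - 1}.  Take m + 1 disjoint copies (layers) of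
   the ground set, put the j-th implication on layer j alone (layer 0 carries
   none), and force the copies of an element in consecutive layers to imply each
   other.  A position then occurs in at most five implications.  The closed sets
   of the new base are the preimages of the old ones under the projection of the
   layers onto the ground set, so the same holds for the inclusion-maximal
   closed sets avoiding an element, and restricting the solutions of the new
   instance to layer 0 gives those of the old one.  The rest is a WHILE program
   for the reduction, composed with a copy of the given program whose variables
   are shifted away from its own. *)

Require Import Defs.
From mathcomp Require Import all_boot zify.
Set Implicit Arguments.
Unset Strict Implicit.
Unset Printing Implicit Defensive.

(** * Bounding the degree by replication *)

Lemma closed_setP (X : finType) (Sigma : {set implication X}) (C : {set X}) :
  reflect (forall p, p \in Sigma -> p.1 \subset C -> p.2 \subset C)
          (closed_set Sigma C).
Proof.
apply: (iffP forall_inP) => [cl p pS|cl p pS]; first exact/implyP/cl.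
exact/implyP/cl.
Qed.

(** * Irreducible closed sets under pullback along a split surjection *)

Section Preimage.
Variables (X Y : finType) (pi : Y -> X) (sec : X -> Y).
Variables (Sigma : {set implication X}) (Sigma' : {set implication Y}).
Hypothesis secK : cancel sec pi.
Hypothesis saturated : forall D : {set Y}, closed_set Sigma' D ->
  forall y z, pi y = pi z -> y \in D -> z \in D.
Hypothesis closed_preim :
  forall C : {set X}, closed_set Sigma' (pi @^-1: C) = closed_set Sigma C.

Lemma preim_sec (C : {set X}) : sec @^-1: (pi @^-1: C) = C.
Proof. by apply/setP => x; rewrite !inE secK. Qed.

Lemma closed_preim_sec (D : {set Y}) :
  closed_set Sigma' D -> pi @^-1: (sec @^-1: D) = D.
Proof.
move=> clD; apply/setP => y; rewrite !inE.
by apply/idP/idP; apply: saturated; rewrite ?secK.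
Qed.

(** Preimages along [pi] and along [sec] are mutually inverse, inclusion-preserving maps between the
    closed sets of [Sigma] and those of [Sigma']. Avoiding [y] upstairs amounts to avoiding [pi y]
    downstairs, so maximality transfers both ways. *)
Lemma mem_irr_at_preim (C : {set X}) (y : Y) :
  (pi @^-1: C \in irr_at Sigma' y) = (C \in irr_at Sigma (pi y)).
Proof.
rewrite !inE; apply/maxsetP/maxsetP; rewrite /= closed_preim !inE.
  move=> [clC maxC]; split=> // B /andP[clB yB] CB.
  suff eqBC : pi @^-1: B = pi @^-1: C by rewrite -[B]preim_sec eqBC preim_sec.
  by apply: maxC; rewrite ?closed_preim ?inE ?clB ?preimsetS.
move=> [clC maxC]; split=> // B /andP[clB yB] CB.
suff eqBC : sec @^-1: B = C by rewrite -(closed_preim_sec clB) eqBC.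
apply: maxC.
  rewrite -closed_preim closed_preim_sec // clB /=.
  by move: yB; rewrite -{1}[B]closed_preim_sec // !inE.
by rewrite -[C]preim_sec preimsetS.
Qed.

Lemma irr_preim : irr Sigma' = [set pi @^-1: C | C : {set X} in irr Sigma].
Proof.
apply/setP => D; apply/bigcupP/imsetP => [[y _ Dy]|[C /bigcupP[x _ Cx] ->]].
  have clD : closed_set Sigma' D.
    by move: Dy; rewrite inE => /maxsetP[/andP[]].
  exists (sec @^-1: D); last by rewrite closed_preim_sec.
  apply/bigcupP; exists (pi y) => //.
  by rewrite -mem_irr_at_preim closed_preim_sec.
by exists (sec x) => //; rewrite mem_irr_at_preim secK.
Qed.

End Preimage.

(* Position j * n + (n - 1 - x) is the copy of x in layer j: words are built by
   prepending, which reverses each layer. *)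
Lemma proj_subproof (n N : nat) (y : 'I_(N * n)) : n.-1 - y %% n < n.
Proof. by case: n y => [|n] y; [case: y => y; rewrite muln0 | lia]. Qed.

Definition proj n N (y : 'I_(N * n)) : 'I_n := Ordinal (proj_subproof y).

Lemma lift_subproof (n N j : nat) (x : 'I_n) (jN : j < N) :
  j * n + (n.-1 - x) < N * n.
Proof. have := ltn_ord x; nia. Qed.

Definition lift_at n N j (jN : j < N) (x : 'I_n) : 'I_(N * n) :=
  Ordinal (lift_subproof x jN).

Lemma lift_atK n N j (jN : j < N) : cancel (@lift_at n N j jN) (@proj n N).
Proof.
move=> x; apply: val_inj => /=; rewrite modnMDl modn_small; have := ltn_ord x; lia.
Qed.

Lemma divn_lift_at n N j (jN : j < N) (x : 'I_n) : lift_at jN x %/ n = j.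
Proof.
have xn := ltn_ord x; rewrite /= divnMDl ?divn_small ?addn0; lia.
Qed.

Lemma proj_eq n N (y z : 'I_(N * n)) : proj y = proj z -> y = z %[mod n].
Proof.
move/(congr1 val) => /=; case: n y z => [|n] y z.
  by have := ltn_ord y; rewrite {2}muln0.
have := @ltn_pmod y n.+1 isT; have := @ltn_pmod z n.+1 isT; lia.
Qed.

(** Indexing by a natural number keeps [i + n] free of range proofs; out of range the set is empty,
    whence the bound in [single_inj]. *)
Definition single N (i : nat) : {set 'I_N} := [set y | val y == i].

Lemma single_sub N (i : 'I_N) (D : {set 'I_N}) : (single N i \subset D) = (i \in D).
Proof.
apply/subsetP/idP => [|iD y]; first by apply; rewrite inE.
by rewrite inE => /eqP/val_inj->.
Qed.

Lemma single_inj N i k : i < N -> single N i = single N k -> i = k.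
Proof. by move=> iN /setP/(_ (Ordinal iN)); rewrite !inE eqxx => /esym/eqP. Qed.

Definition layer n N j (A : {set 'I_n}) : {set 'I_(N * n)} :=
  [set y : 'I_(N * n) | (y %/ n == j) && (proj y \in A)].

Lemma layer_sub n N j (A C : {set 'I_n}) :
  j < N -> (layer N j A \subset @proj n N @^-1: C) = (A \subset C).
Proof.
move=> jN; apply/subsetP/subsetP => [sub x xA|sub y].
  have := sub (lift_at jN x); rewrite !inE divn_lift_at eqxx lift_atK xA; exact.
by rewrite !inE => /andP[_ /sub].
Qed.

Lemma layer_eq0 n N j k (A B : {set 'I_n}) :
  j < N -> j != k -> layer N j A = layer N k B -> A = set0.
Proof.
move=> jN jk /setP eqAB; apply/setP => x; rewrite inE; apply/negbTE/negP => xA.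
have := eqAB (lift_at jN x).
by rewrite !inE divn_lift_at lift_atK xA eqxx (negbTE jk).
Qed.

Definition copy n N j (p : implication 'I_n) : implication 'I_(N * n) :=
  (layer N j p.1, layer N j p.2).

Definition link n N i (b : bool) : implication 'I_(N * n) :=
  if b then (single _ i, single _ (i + n)) else (single _ (i + n), single _ i).

(** * The replicated base and its closed sets *)

Section Reduction.
Variables (n : nat) (l : seq (implication 'I_n)).
Let m := size l.
Let M := m.+1.
Let nth_imp := nth (set0, set0) l.

(** Indices decrease along the list because the program prepends each implication it produces. The
    free layer 0 is present even when [l] is empty. *)
Definition copies k : seq (implication 'I_(M * n)) :=
  [seq copy M j.+1 (nth_imp j) | j <- rev (iota 0 k)].

Definition links k : seq (implication 'I_(M * n)) :=
  [seq link n M i b | i <- rev (iota 0 k), b <- [:: true; false]].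

Definition reduction : seq (implication 'I_(M * n)) := copies m ++ links (m * n).

Lemma mem_reduction q :
  reflect ((exists2 j, j < m & q = copy M j.+1 (nth_imp j)) \/
           (exists i b, i < m * n /\ q = link n M i b))
          (q \in reduction).
Proof.
rewrite mem_cat; apply: (iffP orP) => -[].
- move=> /mapP[j]; rewrite mem_rev mem_iota => jm ->; left; exists j => //; lia.
- move=> /allpairsP[[i b] /= [+ _ ->]]; rewrite mem_rev mem_iota => im.
  by right; exists i, b; split => //; lia.
- move=> [j jm ->]; left; apply/mapP; exists j => //.
  by rewrite mem_rev mem_iota.
- move=> [i [b [im ->]]]; right; apply/allpairsP; exists (i, b); split=> //=.
    by rewrite mem_rev mem_iota.
  by case: b.
Qed.

(** Both sides of a copy lie in one layer, whereas [i] and [i + n] lie in consecutive ones. *)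
Lemma copy_neq_link j i b p : i < m * n -> copy M j p <> link n M i b.
Proof.
move=> im; have iM : i < M * n by rewrite /M mulSn; lia.
have inM : i + n < M * n by rewrite /M mulSn; lia.
have n0 : 0 < n by case: (n) im; lia.
have cp (q : implication 'I_n) :
   single _ i = layer M j q.1 -> single _ (i + n) = layer M j q.2 -> False.
  move=> /setP/(_ (Ordinal iM)); rewrite !inE eqxx => /esym/andP[/eqP /= e1 _].
  move=> /setP/(_ (Ordinal inM)); rewrite !inE eqxx => /esym/andP[/eqP /= + _].
  by rewrite divnDr ?dvdnn // divnn n0; lia.
case: b => -[] e1 e2; first exact: (cp p).
by apply: (cp (p.2, p.1)).
Qed.

Lemma uniq_reduction : uniq l -> uniq reduction.
Proof.
move=> ul; rewrite cat_uniq; apply/and3P; split.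
- rewrite map_inj_in_uniq ?rev_uniq ?iota_uniq // => j k.
  rewrite !mem_rev !mem_iota /= !add0n => jm km [e1 e2].
  apply/eqP/negPn/negP => jk.
  (* Were copies on two different layers equal, all four sides would be empty; both implications
     would then be the empty one, against [uniq l]. *)
  have jk1 : j.+1 != k.+1 by rewrite eqSS.
  have kj1 : k.+1 != j.+1 by rewrite eq_sym.
  have := layer_eq0 _ jk1 e1; have := layer_eq0 _ jk1 e2.
  have := layer_eq0 _ kj1 (esym e1); have := layer_eq0 _ kj1 (esym e2).
  rewrite /M !ltnS => /(_ km) k2 /(_ km) k1 /(_ jm) j2 /(_ jm) j1.
  have /eqP : nth_imp j = nth_imp k.
    rewrite (surjective_pairing (nth_imp j)) (surjective_pairing (nth_imp k)).
    by rewrite k1 k2 j1 j2.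
  by rewrite nth_uniq // (negbTE jk).
- apply/hasPn => q /allpairsP[[i b] /= [+ _ ->]]; rewrite mem_rev mem_iota => im.
  by apply/mapP => -[j _ /esym]; apply: copy_neq_link; lia.
- apply: allpairs_uniq; rewrite ?rev_uniq ?iota_uniq // => -[i b] [k d].
  move=> /allpairsP[[i' b'] [im _ [-> ->]]] /allpairsP[[k' d'] [km _ [-> ->]]] /=.
  move: im km; rewrite /= !mem_rev !mem_iota => im km.
  have le : m * n + n = M * n by rewrite /M mulSn addnC.
  have n0 : 0 < n by case: (n) im; lia.
  case: b' d' => -[] [] /single_inj e1 /single_inj e2;
    move: e1 e2; rewrite -?le => e1 e2;
    have {}e1 := e1 ltac:(lia); have {}e2 := e2 ltac:(lia).
  + by congr (_, _); lia.
  + lia.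
  + lia.
  + by congr (_, _); lia.
Qed.

Lemma size_reduction : size reduction = m + 2 * (m * n).
Proof.
by rewrite size_cat size_map size_allpairs !size_rev !size_iota /=; lia.
Qed.

Variable Sigma : {set implication 'I_n}.
Hypothesis lS : l =i Sigma.
Let Sigma' := [set p in reduction].

Lemma reduction_base : implicational_base Sigma -> implicational_base Sigma'.
Proof.
move=> /forall_inP baseS; apply/forall_inP => q; rewrite inE => /mem_reduction[].
  move=> [j jm ->] /=; rewrite disjoint_subset; apply/subsetP => y.
  rewrite !inE => /andP[-> y1] /=; apply/negP => y2.
  have /baseS : nth_imp j \in Sigma by rewrite -lS mem_nth.
  by move/pred0P/(_ (proj y)); rewrite /= y1 y2.
move=> [i [b [im ->]]].
have n0 : 0 < n by case: (n) im; lia.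
by case: b; rewrite disjoint_subset; apply/subsetP => y;
  rewrite !inE /= => /eqP ->; lia.
Qed.

Lemma degree_reduction : degree Sigma' <= 5.
Proof.
apply/bigmax_leqP => y _.
(* A copy through [y] sits on the layer of [y], and a link through [y] has [y] or [y - n] as its
   smaller position. On layer 0 the truncated [.-1] and [y - n] merely add harmless candidates. *)
pose s := [:: copy M (y %/ n) (nth_imp (y %/ n).-1);
              link n M y true; link n M y false;
              link n M (y - n) true; link n M (y - n) false].
apply: (@leq_trans #|s|); last exact: card_size.
apply/subset_leq_card/subsetP => q; rewrite !inE.
move=> /andP[] /mem_reduction[[j jm ->]|[i [b [im ->]]]] /=.
  by rewrite !inE => /orP[] /andP[/eqP -> _]; rewrite eqxx.
have: (val y == i) || (val y == i + n) ->
    [|| link n M i b == link n M y true, link n M i b == link n M y false,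
        link n M i b == link n M (y - n) true
      | link n M i b == link n M (y - n) false].
  by case/orP => /eqP e; rewrite e ?addnK; case: b; rewrite eqxx ?orbT.
by case: b => H; rewrite !inE /= => h; apply/orP; right; apply: H; rewrite // orbC.
Qed.

(** The two links between [y] and [y + n] make them equivalent in every closed set; iterating leads
    from any position down to its residue modulo [n] in layer 0. *)
Lemma reduction_saturated (D : {set 'I_(M * n)}) : closed_set Sigma' D ->
  forall y z, proj y = proj z -> y \in D -> z \in D.
Proof.
move=> /closed_setP clD.
have step (y z : 'I_(M * n)) : val z = y + n -> (y \in D) = (z \in D).
  move=> e; have im : y < m * n.
    by have := mulSn m n; have := ltn_ord z; rewrite e /M; lia.
  have lk b : link n M y b \in Sigma'.
    by rewrite inE; apply/mem_reduction; right; exists y, b.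
  have := clD _ (lk true); have := clD _ (lk false); rewrite /= -e !single_sub.
  by move=> h1 h2; apply/idP/idP.
have base j : forall (y z : 'I_(M * n)), val y = j * n + z -> (y \in D) = (z \in D).
  elim: j => [|j IH] y z; first by rewrite mul0n => /val_inj->.
  move=> e; have lt : j * n + z < M * n by have := ltn_ord y; rewrite e; lia.
  rewrite -(IH (Ordinal lt) z) //; apply/esym/step; rewrite /= e; lia.
move=> y z /proj_eq eyz.
have lt : y %% n < M * n by apply: leq_ltn_trans (leq_mod _ _) (ltn_ord y).
rewrite (base (y %/ n) y (Ordinal lt)) /=; last exact: divn_eq.
by rewrite (base (z %/ n) z (Ordinal lt)) //= eyz -divn_eq.
Qed.

(** A preimage satisfies every link, as linked positions have the same projection. It satisfies a
    copied implication exactly when [C] satisfies the original, as each layer projects bijectively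
    onto the ground set. *)
Lemma closed_reduction (C : {set 'I_n}) :
  closed_set Sigma' (@proj n M @^-1: C) = closed_set Sigma C.
Proof.
apply/closed_setP/closed_setP => cl p.
  rewrite -lS => pl; have jm : index p l < m by rewrite index_mem.
  have := cl (copy M (index p l).+1 p); rewrite /= !layer_sub //; apply.
  rewrite inE; apply/mem_reduction; left; exists (index p l) => //.
  by rewrite /nth_imp nth_index.
rewrite inE => /mem_reduction[[j jm ->]|[i [b [im ->]]]].
  by rewrite /= !layer_sub //; apply: cl; rewrite -lS mem_nth.
have iM : i < M * n by rewrite /M mulSn; lia.
have inM : i + n < M * n by rewrite /M mulSn; lia.
have e : proj (Ordinal iM) = proj (Ordinal inM).
  by apply: val_inj; rewrite /= modnDr.
have := single_sub (Ordinal iM) (@proj n M @^-1: C).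
have := single_sub (Ordinal inM) (@proj n M @^-1: C).
by case: b => /= -> ->; rewrite !inE e.
Qed.

Lemma irr_reduction :
  irr Sigma' = [set @proj n M @^-1: C | C : {set 'I_n} in irr Sigma].
Proof.
exact: (irr_preim (lift_atK (ltn0Sn m)) reduction_saturated closed_reduction).
Qed.

End Reduction.

(** * Time-bounded reasoning about WHILE programs *)

Fixpoint shift_expr k (e : expr) : expr :=
  match e with
  | EVar x => EVar (k + x)
  | ELeaf => ELeaf
  | ENode e1 e2 => ENode (shift_expr k e1) (shift_expr k e2)
  | ELeft e1 => ELeft (shift_expr k e1)
  | ERight e1 => ERight (shift_expr k e1)
  end.

Fixpoint shift k (c : cmd) : cmd :=
  match c with
  | Assign x e => Assign (k + x) (shift_expr k e)
  | Seq c1 c2 => Seq (shift k c1) (shift k c2)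
  | If e c1 c2 => If (shift_expr k e) (shift k c1) (shift k c2)
  | While e c1 => While (shift_expr k e) (shift k c1)
  end.

Lemma cost_shift k e : cost (shift_expr k e) = cost e.
Proof. by elim: e => //= [e1 -> e2 ->|e ->|e ->]. Qed.

Lemma eval_shift k e s s1 : (forall x, s1 (k + x) = s x) ->
  eval s1 (shift_expr k e) = eval s e.
Proof. by move=> es; elim: e => //= [e1 -> e2 ->|e ->|e ->]. Qed.

(** Renaming leaves the number of steps unchanged. The variables below [k] survive, so one of them
    can keep [n] while the given program runs. *)
Lemma exec_shift k c s T s' : exec c s T s' ->
  forall s1, (forall x, s1 (k + x) = s x) ->
  exists2 s1', exec (shift k c) s1 T s1' &
    (forall x, s1' (k + x) = s' x) /\ (forall x, x < k -> s1' x = s1 x).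
Proof.
elim=> {c s T s'} /=.
- move=> x e s s1 es; exists (update s1 (k + x) (eval s1 (shift_expr k e))).
    by rewrite -(cost_shift k); constructor.
  split=> y; rewrite /update ?eqn_add2l ?(eval_shift _ es) ?es // => yk.
  by case: eqP => //; lia.
- move=> c1 c2 s T1 s1 T2 s2 _ IH1 _ IH2 t es.
  have [t1 ex1 [es1 fr1]] := IH1 _ es; have [t2 ex2 [es2 fr2]] := IH2 _ es1.
  by exists t2; [exact: ExecSeq ex1 ex2 | split=> // x xk; rewrite fr2 ?fr1].
- move=> e c1 c2 s T s' nd _ IH t es; have [t1 ex1 [es1 fr1]] := IH _ es.
  exists t1; last by split.
  by rewrite -(cost_shift k e); apply: ExecIfTrue; rewrite ?(eval_shift _ es).
- move=> e c1 c2 s T s' nd _ IH t es; have [t1 ex1 [es1 fr1]] := IH _ es.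
  exists t1; last by split.
  by rewrite -(cost_shift k e); apply: ExecIfFalse; rewrite ?(eval_shift _ es).
- move=> e c s T1 s1 T2 s2 nd _ IH1 _ IH2 t es.
  have [t1 ex1 [es1 fr1]] := IH1 _ es; have [t2 ex2 [es2 fr2]] := IH2 _ es1.
  exists t2; last by split=> // x xk; rewrite fr2 ?fr1.
  rewrite -(cost_shift k); apply: ExecWhileTrue ex1 ex2.
  by rewrite (eval_shift _ es).
- move=> e c s nd t es; exists t; last by split.
  by rewrite -(cost_shift k); constructor; rewrite (eval_shift _ es).
Qed.

Fixpoint assigned (c : cmd) : seq nat :=
  match c with
  | Assign x _ => [:: x]
  | Seq c1 c2 | If _ c1 c2 => assigned c1 ++ assigned c2
  | While _ c1 => assigned c1
  end.

Definition frame (c : cmd) (s s' : store) : Prop :=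
  forall x, x \notin assigned c -> s' x = s x.

Lemma exec_frame c s T s' : exec c s T s' -> frame c s s'.
Proof.
elim=> {c s T s'} //=.
- by move=> x e s y /=; rewrite inE /update => /negbTE->.
- move=> c1 c2 s T1 s1 T2 s2 _ IH1 _ IH2 x /=.
  by rewrite mem_cat => /norP[x1 x2]; rewrite IH2 ?IH1.
- by move=> e c1 c2 s T s' _ _ IH x /=; rewrite mem_cat => /norP[x1 x2]; rewrite IH.
- by move=> e c1 c2 s T s' _ _ IH x /=; rewrite mem_cat => /norP[x1 x2]; rewrite IH.
- by move=> e c s T1 s1 T2 s2 _ _ IH1 _ IH2 x xc; rewrite IH2 ?IH1.
Qed.

(** A total-correctness triple with a time bound. Its frame clause spares invariants from listing
    the variables that the command does not assign. *)
Definition terminates (c : cmd) (s : store) (B : nat) (Q : store -> Prop) : Prop :=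
  exists T s', [/\ exec c s T s', T <= B, frame c s s' & Q s'].

Lemma terminatesW c s B B' (Q Q' : store -> Prop) :
  B <= B' -> (forall s', frame c s s' -> Q s' -> Q' s') ->
  terminates c s B Q -> terminates c s B' Q'.
Proof.
move=> BB QQ [T [s' [ex TB fr q]]]; exists T, s'.
by split=> //; [exact: leq_trans BB | exact: QQ].
Qed.

Lemma terminates_assign x e s (Q : store -> Prop) :
  Q (update s x (eval s e)) -> terminates (Assign x e) s (cost e).+1 Q.
Proof.
move=> q; exists (cost e).+1, (update s x (eval s e)).
by have ex := ExecAssign x e s; split=> //; exact: exec_frame ex.
Qed.

Lemma terminates_seq c1 c2 s B1 B2 (Q1 Q : store -> Prop) :
  terminates c1 s B1 Q1 ->
  (forall s1, frame c1 s s1 -> Q1 s1 -> terminates c2 s1 B2 Q) ->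
  terminates (Seq c1 c2) s (B1 + B2).+1 Q.
Proof.
move=> [T1 [s1 [ex1 TB1 fr1 q1]]] /(_ s1 fr1 q1) [T2 [s2 [ex2 TB2 fr2 q2]]].
exists (T1 + T2).+1, s2; have ex := ExecSeq ex1 ex2.
by split=> //; [rewrite ltnS leq_add | exact: exec_frame ex].
Qed.

(* Running through a list destroys the variable y that holds it. *)
Definition for_each (x y : nat) (c : cmd) : cmd :=
  While (EVar y)
    (Seq (Assign x (ELeft (EVar y))) (Seq (Assign y (ERight (EVar y))) c)).

(** [I j] holds before item [j] is processed. An iteration costs 10 steps besides [c]: 3 for each of
    two assignments, 2 for sequencing, 2 for the test and the loop. The final failing test costs
    2. *)
Lemma terminates_for_each x y c l (I : nat -> store -> Prop) B s
    (Q : store -> Prop) :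
  x != y -> y \notin assigned c -> s y = encode_seq l -> I 0 s ->
  (forall j t, j < size l -> frame (for_each x y c) s t -> I j t ->
     terminates c
       (update (update t x (nth Leaf l j)) y (encode_seq (drop j.+1 l)))
       B (I j.+1)) ->
  (forall t, frame (for_each x y c) s t -> I (size l) t -> Q t) ->
  terminates (for_each x y c) s (size l * (B + 10) + 2) Q.
Proof.
move=> xy yc sy I0 step IQ; apply: (terminatesW (leqnn _) IQ).
suff loop k : forall j t, j + k = size l -> t y = encode_seq (drop j l) ->
    frame (for_each x y c) s t -> I j t ->
    terminates (for_each x y c) t (k * (B + 10) + 2) (I (size l)).
  by apply: (loop _ 0); rewrite ?add0n ?drop0 // => v _.
elim: k => [|k IH] j t jk ty frt Ijt.
  have ex : exec (for_each x y c) t 2 t.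
    by apply: (ExecWhileFalse (e := EVar y)); rewrite /= ty drop_oversize //; lia.
  exists 2, t; split=> //.
  by have <- : j = size l by lia.
have jl : j < size l by lia.
have {}ty : t y = Node (nth Leaf l j) (encode_seq (drop j.+1 l)).
  by rewrite ty (drop_nth Leaf jl).
have [T1 [t1 [ex1 TB1 fr1 I1]]] := step j t jl frt Ijt.
have exa := ExecAssign x (ELeft (EVar y)) t.
have exb := ExecAssign y (ERight (EVar y)) (update t x (nth Leaf l j)).
have uy : update t x (nth Leaf l j) y = t y by rewrite /update eq_sym (negbTE xy).
move: exa exb; rewrite /= uy ty /= => exa exb.
have exc := ExecSeq exa (ExecSeq exb ex1).
have frt1 : frame (for_each x y c) s t1.
  by move=> v vc; rewrite (exec_frame exc vc) frt.
have t1y : t1 y = encode_seq (drop j.+1 l) by rewrite fr1 // /update eqxx.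
have [|T2 [t2 [ex2 TB2 _ I2]]] := IH j.+1 t1 _ t1y frt1 I1; first lia.
have nd : is_node (eval t (EVar y)) by rewrite /= ty.
have ex := ExecWhileTrue nd exc ex2.
do 2 eexists; split; [exact: ex | | exact: exec_frame ex | exact: I2].
by rewrite /=; lia.
Qed.

(** * Programs for the reduction *)

(** The same list is both the number [k] in unary and a word of [k] zero bits, since
    [encode_bool false] is [Leaf]. *)
Notation zeros k := (nseq k Leaf).

Definition bits n (A : {set 'I_n}) : seq tree :=
  [seq encode_bool (i \in A) | i <- enum 'I_n].

Lemma size_bits n (A : {set 'I_n}) : size (bits A) = n.
Proof. by rewrite size_map size_enum_ord. Qed.

Lemma nth_bits n (A : {set 'I_n}) (i : 'I_n) :
  nth Leaf (bits A) i = encode_bool (i \in A).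
Proof. by rewrite (nth_map i) ?size_enum_ord // nth_ord_enum. Qed.

Lemma encode_setE n (A : {set 'I_n}) w : size w = n ->
  (forall i : 'I_n, nth Leaf w i = encode_bool (i \in A)) ->
  encode_seq w = encode_set A.
Proof.
move=> sw ew; congr encode_seq.
apply: (eq_from_nth (x0 := Leaf)); rewrite sw ?size_bits // => i i_n.
by rewrite (ew (Ordinal i_n)) -nth_bits.
Qed.

Lemma catrev_zeros a b : catrev (zeros a) (zeros b) = zeros (a + b).
Proof. by rewrite catrevE rev_nseq nseqD. Qed.

(** [catrev] mirrors the loops that build words by prepending. Reversing a constant word changes
    nothing; reversing [bits A] is what [proj] accounts for. *)
Lemma encode_layer n m j (A : {set 'I_n}) : j <= m ->
  encode_seq (catrev (zeros (j * n)) (catrev (bits A) (zeros ((m - j) * n))))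
  = encode_set (layer m.+1 j A).
Proof.
move=> jm; apply: encode_setE => [|y].
  by rewrite !catrevE !size_cat !size_rev !size_nseq size_bits; nia.
have yN := ltn_ord y.
have n0 : 0 < n by have := leq_ltn_trans (leq0n y) yN; rewrite muln_gt0 => /andP[].
have lt1 : y %% n < n by rewrite ltn_pmod.
have dy := divn_eq y n.
rewrite !catrevE !inE !nth_cat !size_rev !size_nseq size_bits rev_nseq !nth_nseq.
(* The position is before, inside or after layer [j]. *)
case: (ltnP y (j * n)) => yj.
  by case: eqP => // e; move: dy; rewrite e; lia.
case: (ltnP (y - j * n) n) => yj2.
  have e : y %/ n = j by nia.
  rewrite e eqxx nth_rev size_bits //= -nth_bits /=; congr nth.
  by move: dy; rewrite e; lia.
by rewrite ?if_same; case: eqP => // e; move: dy; rewrite e; lia.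
Qed.

Lemma encode_single N i : i < N ->
  encode_seq (catrev (zeros i) (encode_bool true :: zeros (N - i.+1)))
  = encode_set (single N i).
Proof.
move=> iN; apply: encode_setE => [|y].
  by rewrite catrevE size_cat size_rev /= !size_nseq; lia.
rewrite catrevE inE nth_cat size_rev size_nseq rev_nseq nth_nseq.
case: ltnP => yi; first by case: eqP => //= e; lia.
case: eqP => [e|ne]; first by rewrite /= e subnn.
have -> : y - i = (y - i.+1).+1 by rewrite /= in ne; lia.
by rewrite /= nth_nseq if_same.
Qed.

(** Applied first, it leaves the bound open: the rules accumulate it along the program, and one
    final inequality compares it with the stated bound. *)
Lemma terminates_le c s B B' Q : terminates c s B Q -> B <= B' -> terminates c s B' Q.
Proof. by move=> h BB; apply: terminatesW BB _ h. Qed.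

Lemma terminates_assign_seq x e c s B Q :
  terminates c (update s x (eval s e)) B Q ->
  terminates (Seq (Assign x e) c) s (cost e + B).+2 Q.
Proof.
move=> h; have := terminates_seq (c1 := Assign x e) (s := s) (B1 := (cost e).+1)
  (Q1 := fun t => t = update s x (eval s e)) (c2 := c) (B2 := B) (Q := Q).
rewrite addSn; apply; first exact: terminates_assign.
by move=> s1 _ ->.
Qed.

(* Variables of the programs below:
   0 input, later output; 1 n in unary; 2 the implications;
   3 m * n in unary, later the solutions; 4 zeros preceding the current layer;
   5, 6 words under construction; 7 the implications produced so far;
   8, 9 and 10, 11 and 12, 13 current item and rest of the list of a loop;
   14 zeros following the current layer;
   20 and above: the variables of the given program. *)
Definition rev_onto (e : expr) (dst : nat) : cmd :=
  Seq (Assign 9 e) (for_each 8 9 (Assign dst (ENode (EVar 8) (EVar dst)))).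

Lemma terminates_rev_onto e dst s a b :
  dst != 8 -> dst != 9 -> eval s e = encode_seq a -> s dst = encode_seq b ->
  terminates (rev_onto e dst) s (14 * size a + cost e + 4)
    (fun t => t dst = encode_seq (catrev a b)).
Proof.
move=> d8 d9 ea eb; apply: terminates_le; first apply: terminates_assign_seq.
  apply: (terminates_for_each (l := a) (B := 4)
            (I := fun j t => t dst = encode_seq (catrev (take j a) b))) => //=.
  - by rewrite inE eq_sym.
  - by rewrite take0 /update (negbTE d9).
  - move=> j t ja _ It; apply: terminates_assign; rewrite /update eqxx /=.
    by rewrite (negbTE d8) (negbTE d9) It (take_nth Leaf ja) !catrevE rev_rcons.
  - by move=> t _; rewrite take_size.
by lia.
Qed.

(** Unary multiplication by [n]. Only the length of [src] matters, so [src] may hold a list of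
    implications. *)
Definition mul_zeros (src dst : nat) : cmd :=
  Seq (Assign dst ELeaf)
    (Seq (Assign 13 (EVar src)) (for_each 12 13 (rev_onto (EVar 1) dst))).

Lemma terminates_mul_zeros n src dst s l :
  src != dst -> dst \notin [:: 1; 8; 9; 12; 13] ->
  s 1 = encode_seq (zeros n) -> s src = encode_seq l ->
  terminates (mul_zeros src dst) s (size l * (14 * n + 15) + 8)
    (fun t => t dst = encode_seq (zeros (size l * n))).
Proof.
rewrite !inE !negb_or => sd /and5P[d1 d8 d9 d12 d13] e1 el.
apply: terminates_le; first do 2 apply: terminates_assign_seq.
  apply: (terminates_for_each (l := l) (B := 14 * n + 5)
            (I := fun j t => t dst = encode_seq (zeros (j * n)))) => //=.
  - by rewrite !inE negb_or /= eq_sym.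
  - by rewrite /update /= (negbTE sd).
  - by rewrite /update (negbTE d13) eqxx.
  - move=> j t jl fr It; apply: terminates_le.
      apply: (terminatesW (leqnn _)); last first.
        apply: (terminates_rev_onto (a := zeros n) (b := zeros (j * n))) => //.
          rewrite /= /update /= fr /update /= ?inE ?negb_or //=.
            by rewrite eq_sym (negbTE d1).
          by rewrite eq_sym d1.
        by rewrite /update (negbTE d12) (negbTE d13).
      by move=> t' _ ->; rewrite catrev_zeros mulSn.
    by rewrite size_nseq /=; lia.
rewrite /=; lia.
Qed.

(** Variable 11, the rest of the enclosing loop over [m * n] zeros, holds exactly the zeros that
    follow position [i + n]. The [n] zeros of variable 1 go behind the one in the word for [i], and
    before it in the word for [i + n]. *)
Definition put_links : cmd :=
  Seq (Assign 5 (EVar 11)) (Seq (rev_onto (EVar 1) 5)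
  (Seq (Assign 5 (ENode (ENode ELeaf ELeaf) (EVar 5))) (Seq (rev_onto (EVar 4) 5)
  (Seq (Assign 6 (ENode (ENode ELeaf ELeaf) (EVar 11))) (Seq (rev_onto (EVar 1) 6)
  (Seq (rev_onto (EVar 4) 6)
  (Seq (Assign 7 (ENode (ENode (EVar 5) (EVar 6))
                        (ENode (ENode (EVar 6) (EVar 5)) (EVar 7))))
       (Assign 4 (ENode ELeaf (EVar 4)))))))))).

Lemma rev_iota_recl k : rev (iota 0 k.+1) = k :: rev (iota 0 k).
Proof. by rewrite -addn1 iotaD cats1 rev_rcons. Qed.

Lemma links_recl n (l : seq (implication 'I_n)) k :
  links l k.+1 = link n (size l).+1 k true :: link n (size l).+1 k false :: links l k.
Proof. by rewrite /links rev_iota_recl. Qed.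

Lemma terminates_put_links n (l : seq (implication 'I_n)) i s :
  i < size l * n ->
  s 1 = encode_seq (zeros n) -> s 4 = encode_seq (zeros i) ->
  s 7 = encode_seq (map (@encode_implication _) (links l i)) ->
  s 11 = encode_seq (zeros (size l * n - i.+1)) ->
  terminates put_links s (56 * ((size l).+1 * n) + 100)
    (fun t => t 4 = encode_seq (zeros i.+1) /\
       t 7 = encode_seq (map (@encode_implication _) (links l i.+1))).
Proof.
move=> im s1 s4 s7 s11; set m := size l in im s11 *.
apply: terminates_le; first apply: terminates_assign_seq.
  apply: terminates_seq => [|t1 f1 t15].
    exact: (terminates_rev_onto (a := zeros n) (b := zeros (m * n - i.+1))).
  apply: terminates_assign_seq; apply: terminates_seq => [|t2 f2 t25].
    apply: (terminates_rev_onto (a := zeros i)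
             (b := encode_bool true :: zeros (m.+1 * n - i.+1))) => //.
      by rewrite /= /update /= f1.
    rewrite /update /= t15 catrev_zeros; congr (Node _ (encode_seq (zeros _))); lia.
  apply: terminates_assign_seq; apply: terminates_seq => [|t3 f3 t36].
    apply: (terminates_rev_onto (a := zeros n)
              (b := encode_bool true :: zeros (m * n - i.+1))) => //.
      by rewrite /= /update /= f2 // /update /= f1.
    by rewrite /update /= f2 // /update /= f1 // /update /= s11.
  apply: terminates_seq => [|t4 f4 t46].
    apply: (terminates_rev_onto (a := zeros i)) t36 => //.
    by rewrite /= f3 // /update /= f2 // /update /= f1.
  apply: terminates_assign_seq; apply: terminates_assign.
  have t45 : t4 5 = encode_set (single (m.+1 * n) i).
    rewrite -encode_single; last by lia.
    by rewrite f4 // f3 // /update /= t25.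
  have {}t46 : t4 6 = encode_set (single (m.+1 * n) (i + n)).
    rewrite -encode_single ?t46; last by lia.
    rewrite !catrevE !rev_nseq catA -nseqD.
    congr (encode_seq (_ ++ _ :: zeros _)); lia.
  rewrite /update /= t45 t46.
  have -> : t4 4 = s 4 by rewrite f4 // f3 // /update /= f2 // /update /= f1.
  have -> : t4 7 = s 7 by rewrite f4 // f3 // /update /= f2 // /update /= f1.
  by rewrite s4 s7 links_recl.
rewrite /= !size_nseq; lia.
Qed.

(** The implications remaining in variable 11 are as many as the layers after the current one, which
    gives the padding in variable 14. *)
Definition put_copy : cmd :=
  Seq (mul_zeros 11 14)
  (Seq (Assign 5 (EVar 14))
  (Seq (rev_onto (ELeft (EVar 10)) 5) (Seq (rev_onto (EVar 4) 5)
  (Seq (Assign 6 (EVar 14))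
  (Seq (rev_onto (ERight (EVar 10)) 6) (Seq (rev_onto (EVar 4) 6)
  (Seq (Assign 7 (ENode (ENode (EVar 5) (EVar 6)) (EVar 7)))
       (rev_onto (EVar 1) 4)))))))).

Lemma copies_recl n (l : seq (implication 'I_n)) k :
  copies l k.+1 = copy (size l).+1 k.+1 (nth (set0, set0) l k) :: copies l k.
Proof. by rewrite /copies rev_iota_recl. Qed.

(** After [j] implications variable 4 already spans [j.+1] layers, as layer 0 is skipped. The list
    [r] stands for the links, produced earlier. *)
Lemma terminates_put_copy n (l : seq (implication 'I_n)) j s r :
  j < size l ->
  s 1 = encode_seq (zeros n) -> s 4 = encode_seq (zeros (j.+1 * n)) ->
  s 7 = encode_seq (map (@encode_implication _) (copies l j ++ r)) ->
  s 10 = encode_implication (nth (set0, set0) l j) ->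
  s 11 = encode_seq (drop j.+1 (map (@encode_implication _) l)) ->
  terminates put_copy s (100 * ((size l).+1 * n.+1) + 100)
    (fun t => t 4 = encode_seq (zeros (j.+2 * n)) /\
       t 7 = encode_seq (map (@encode_implication _) (copies l j.+1 ++ r))).
Proof.
move=> jm s1 s4 s7 s10 s11; set m := size l in jm *.
set p := nth _ _ _ in s10 *.
apply: terminates_le; first apply: terminates_seq => [|t0 f0 t0E].
    exact: terminates_mul_zeros s1 s11.
  rewrite size_drop size_map -/m in t0E.
  apply: terminates_assign_seq; apply: terminates_seq => [|t1 f1 t15].
    apply: (terminates_rev_onto (a := bits p.1)) t0E => //.
    by rewrite /= /update /= f0 // s10.
  apply: terminates_seq => [|t2 f2 t25].
    apply: (terminates_rev_onto (a := zeros (j.+1 * n))) t15 => //.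
    by rewrite /= f1 // /update /= f0.
  apply: terminates_assign_seq; apply: terminates_seq => [|t3 f3 t36].
    apply: (terminates_rev_onto (a := bits p.2) (b := zeros ((m - j.+1) * n))) => //.
      by rewrite /= /update /= f2 // f1 // /update /= f0 // s10.
    by rewrite /update /= f2 // f1.
  apply: terminates_seq => [|t4 f4 t46].
    apply: (terminates_rev_onto (a := zeros (j.+1 * n))) t36 => //.
    by rewrite /= f3 // /update /= f2 // f1 // /update /= f0.
  apply: terminates_assign_seq; apply: (terminatesW (leqnn _)); last first.
    apply: (terminates_rev_onto (a := zeros n) (b := zeros (j.+1 * n))) => //.
      by rewrite /= /update /= f4 // f3 // /update /= f2 // f1 // /update /= f0.
    by rewrite /update /= f4 // f3 // /update /= f2 // f1 // /update /= f0.
  move=> t5 f5 t54; split; first by rewrite t54 catrev_zeros -mulSn.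
  rewrite f5 // /update /= t46 encode_layer //.
  have -> : t4 5 = encode_set (layer m.+1 j.+1 p.1).
    by rewrite f4 // f3 // /update /= t25 encode_layer.
  have -> : t4 7 = s 7 by rewrite f4 // f3 // /update /= f2 // f1 // /update /= f0.
  by rewrite s7 copies_recl.
rewrite /= size_drop size_map !size_nseq !size_bits -/m.
have : j.+1 * n <= m * n by rewrite leq_mul2r jm orbT.
have : (m - j.+1) * (14 * n + 15) <= m * (14 * n + 15).
  by rewrite leq_mul2r leq_subr orbT.
nia.
Qed.

(** Links are produced before copies because prepending puts the later ones in front. Variable 4
    restarts from [n] zeros to skip layer 0. Variable 20 is the input variable of the shifted
    program. *)
Definition preprocess : cmd :=
  Seq (Assign 1 (ELeft (EVar 0))) (Seq (Assign 2 (ERight (EVar 0)))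
  (Seq (mul_zeros 2 3)
  (Seq (Assign 11 (EVar 3)) (Seq (for_each 10 11 put_links)
  (Seq (Assign 4 (EVar 1)) (Seq (Assign 11 (EVar 2)) (Seq (for_each 10 11 put_copy)
  (Seq (rev_onto (EVar 1) 3) (Assign 20 (ENode (EVar 3) (EVar 7))))))))))).

Definition preprocess_bound n m :=
  m * (14 * n + 15) + 14 * n + m * n * (56 * (m.+1 * n) + 110)
  + m * (100 * (m.+1 * n.+1) + 110) + 100.

Lemma terminates_preprocess n (l : seq (implication 'I_n)) s :
  s 0 = encode_input l -> s 4 = Leaf -> s 7 = Leaf ->
  terminates preprocess s (preprocess_bound n (size l))
    (fun t => t 1 = encode_unary n /\ t 20 = encode_input (reduction l)).
Proof.
move=> s0 s4 s7; set m := size l.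
apply: terminates_le; first do 2 apply: terminates_assign_seq.
  apply: terminates_seq => [|t0 f0 t03].
    apply: (terminates_mul_zeros (n := n) (l := map (@encode_implication _) l)) => //.
      by rewrite /update /= s0.
    by rewrite /update /= s0.
  rewrite size_map -/m in t03.
  have e1 : t0 1 = encode_seq (zeros n) by rewrite f0 // /update /= s0.
  have e2 : t0 2 = encode_seq (map (@encode_implication _) l).
    by rewrite f0 // /update /= s0.
  have e4 : t0 4 = Leaf by rewrite f0.
  have e7 : t0 7 = Leaf by rewrite f0.
  apply: terminates_assign_seq.
  apply: terminates_seq => [|t1 f1 t17].
    apply: (terminates_for_each (l := zeros (m * n)) (B := 56 * (m.+1 * n) + 100)
      (I := fun i t => t 4 = encode_seq (zeros i) /\
              t 7 = encode_seq (map (@encode_implication _) (links l i)))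
      (Q := fun t =>
              t 7 = encode_seq (map (@encode_implication _) (links l (m * n))))) => //.
      move=> i t; rewrite size_nseq => im f [t4 t7].
      apply: terminates_put_links; rewrite // /update /=.
        by rewrite f.
      by rewrite drop_nseq.
    by move=> t _ []; rewrite size_nseq.
  do 2 apply: terminates_assign_seq.
  apply: terminates_seq => [|t2 f2 t27].
    apply: (terminates_for_each (l := map (@encode_implication _) l)
      (B := 100 * (m.+1 * n.+1) + 100)
      (I := fun j t => t 4 = encode_seq (zeros (j.+1 * n)) /\
              t 7 = encode_seq (map (@encode_implication _)
                                  (copies l j ++ links l (m * n))))
      (Q := fun t => t 7 = encode_seq (map (@encode_implication _) (reduction l)))) => //.
    - by rewrite /update /= f1.
    - by split=> //; rewrite /update /= f1 // /update /= e1 mul1n.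
    - move=> j t; rewrite size_map => jm f [t4 t7].
      apply: terminates_put_copy; rewrite // /update /=.
        by rewrite f // /update /= f1.
      exact: nth_map.
    - by move=> t _ []; rewrite size_map.
  (* Another [n] zeros turn [m * n] into the size [m.+1 * n] of the new ground set. *)
  apply: terminates_seq => [|t3 f3 t33].
    apply: (terminates_rev_onto (a := zeros n) (b := zeros (m * n))) => //.
      by rewrite /= f2 // /update /= f1.
    by rewrite f2 // /update /= f1.
  apply: terminates_assign; rewrite /update /=; split.
    by rewrite f3 // f2 // /update /= f1.
  by rewrite t33 f3 // t27 catrev_zeros -mulSn.
rewrite /= !size_map !size_nseq /preprocess_bound -/m; lia.
Qed.

(** * Restriction of the solutions to layer 0 *)

Definition put_restriction : cmd :=
  Seq (Assign 5 ELeaf) (Seq (Assign 9 (EVar 1))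
  (Seq (for_each 8 9 (Seq (Assign 5 (ENode (ELeft (EVar 10)) (EVar 5)))
                          (Assign 10 (ERight (EVar 10)))))
       (Assign 3 (ENode (EVar 5) (EVar 3))))).

Definition postprocess : cmd :=
  Seq (Assign 3 ELeaf) (Seq (Assign 11 (EVar 20))
  (Seq (for_each 10 11 put_restriction) (Assign 0 (EVar 3)))).

Definition restrict n m (D : {set 'I_(m.+1 * n)}) : {set 'I_n} :=
  lift_at (ltn0Sn m) @^-1: D.

(** Layer 0 occupies the first [n] bits in reversed order; prepending them one by one restores the
    order. *)
Lemma encode_restrict n m (D : {set 'I_(m.+1 * n)}) :
  encode_seq (catrev (take n (bits D)) [::]) = encode_set (restrict D).
Proof.
have sz : size (take n (bits D)) = n by rewrite size_takel // size_bits; lia.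
rewrite catrevE cats0; apply: encode_setE => [|x]; first by rewrite size_rev.
rewrite inE -nth_bits nth_rev sz // nth_take /=; last by have := ltn_ord x; lia.
by congr nth; have := ltn_ord x; lia.
Qed.

(** The inner loop consumes variable 10, the current item of the enclosing loop; that loop only
    needs variable 11 preserved. *)
Lemma terminates_put_restriction n m (D : {set 'I_(m.+1 * n)}) r s :
  s 1 = encode_unary n -> s 10 = encode_set D -> s 3 = encode_seq r ->
  terminates put_restriction s (30 * n + 30)
    (fun t => t 3 = encode_seq (encode_set (restrict D) :: r)).
Proof.
move=> s1 s10 s3; apply: terminates_le; first do 2 apply: terminates_assign_seq.
  apply: terminates_seq => [|t1 f1 t15].
    apply: (terminates_for_each (l := zeros n) (B := 9)
      (I := fun i t => t 5 = encode_seq (catrev (take i (bits D)) [::]) /\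
                       t 10 = encode_seq (drop i (bits D)))
      (Q := fun t => t 5 = encode_set (restrict D))) => //.
    - by rewrite take0 drop0.
    - move=> i t; rewrite size_nseq => i_n f [t5 t10].
      have iD : i < size (bits D) by rewrite size_bits; lia.
      apply: terminates_le; first apply: terminates_assign_seq.
        apply: terminates_assign; rewrite /update /= t5 t10 (drop_nth Leaf iD) /=.
        by rewrite (take_nth Leaf iD) !catrevE rev_rcons.
      by [].
    - by move=> t _ []; rewrite size_nseq encode_restrict.
  by apply: terminates_assign; rewrite /update /= t15 f1 // /update /= s3.
by rewrite /= size_nseq; lia.
Qed.

Lemma terminates_postprocess n m (sol : seq {set 'I_(m.+1 * n)}) s :
  s 1 = encode_unary n -> s 20 = encode_output sol ->
  terminates postprocess s (size sol * (30 * n + 40) + 20)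
    (fun t => t 0 = encode_output (rev (map (@restrict n m) sol))).
Proof.
move=> s1 s20; apply: terminates_le; first do 2 apply: terminates_assign_seq.
  apply: terminates_seq => [|t1 f1 t13].
    apply: (terminates_for_each (l := map (@encode_set _) sol) (B := 30 * n + 30)
      (I := fun i t => t 3 = encode_output (rev (map (@restrict n m) (take i sol))))
      (Q := fun t => t 3 = encode_output (rev (map (@restrict n m) sol)))) => //.
    - by rewrite take0.
    - move=> i t; rewrite size_map => i_n f t3.
      rewrite (nth_map set0) // (take_nth set0 i_n) map_rcons rev_rcons.
      by apply: terminates_put_restriction; rewrite // /update /= f.
    - by move=> t _; rewrite size_map take_size.
  by apply: terminates_assign; rewrite /update /=.
by rewrite /= size_map; lia.
Qed.

(** * Polynomial bounds *)

Definition poly_bounded (f : nat -> nat) : Prop :=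
  exists a k, forall x, f x <= a * x ^ k + a.

(** This brings bounds with different exponents to the common exponent [j + k]; the extra 1 covers
    [x = 0] with [j = 0]. *)
Lemma leq_expS_add x j k : x ^ j <= x ^ (j + k) + 1.
Proof.
case: x => [|x]; first apply: leq_trans (leq_addl _ _).
  by case: j => // j; rewrite exp0n.
by apply: leq_trans (leq_addr _ _); rewrite leq_pexp2l // leq_addr.
Qed.

Lemma poly_bounded_const c : poly_bounded (fun=> c).
Proof. by exists c, 0 => x; rewrite leq_addl. Qed.

Lemma poly_bounded_id : poly_bounded id.
Proof. by exists 1, 1 => x; rewrite expn1; lia. Qed.

Lemma poly_bounded_add f g :
  poly_bounded f -> poly_bounded g -> poly_bounded (fun x => f x + g x).
Proof.
move=> [a [j fa]] [b [k gb]]; exists (2 * (a + b)), (j + k) => x.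
have := leq_expS_add x j k; have := leq_expS_add x k j; rewrite (addnC k j).
by have := fa x; have := gb x; nia.
Qed.

Lemma poly_bounded_succ f : poly_bounded f -> poly_bounded (fun x => (f x).+1).
Proof.
by move=> [a [k fa]]; exists a.+1, k => x; have := fa x; rewrite mulSn; lia.
Qed.

Lemma poly_bounded_mul f g :
  poly_bounded f -> poly_bounded g -> poly_bounded (fun x => f x * g x).
Proof.
move=> [a [j fa]] [b [k gb]]; exists (3 * (a * b)), (j + k) => x.
have := leq_expS_add x j k; have := leq_expS_add x k j; rewrite (addnC k j).
have := leq_mul (fa x) (gb x); rewrite expnD => le1 le2 le3.
apply: leq_trans le1 _.
have -> : (a * x ^ j + a) * (b * x ^ k + b) =
    a * b * (x ^ j * x ^ k + x ^ j + x ^ k + 1) by nia.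
have -> : 3 * (a * b) * (x ^ j * x ^ k) + 3 * (a * b) =
    a * b * (3 * (x ^ j * x ^ k) + 3) by nia.
rewrite leq_mul2l; apply/orP; right; lia.
Qed.

Lemma poly_bounded_exp f k : poly_bounded f -> poly_bounded (fun x => f x ^ k).
Proof.
move=> pf; elim: k => [|k IH]; first exact: (poly_bounded_const 1).
have [a [j fa]] := poly_bounded_mul pf IH; exists a, j => x; rewrite expnS; exact: fa.
Qed.

Theorem theorem43 :
  (forall c : nat, exists P : cmd,
     output_poly_ICS_Enum
       (fun (n : nat) (Sigma : {set implication 'I_n}) => degree Sigma <= c) P) ->
  exists P : cmd,
    output_poly_ICS_Enum
      (fun (n : nat) (Sigma : {set implication 'I_n}) => True) P.
Proof.
move=> /(_ 5) [P [a [k solve]]].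
exists (Seq preprocess (Seq (shift 20 P) postprocess)).
(* The summands bound preprocessing, the given program on the new instance, and postprocessing; 2
   pays for the two sequencings. *)
pose f x := preprocess_bound x x
  + (a * (x.+1 * x + (x + 2 * (x * x)) + x) ^ k + a) + (x * (30 * x + 40) + 20) + 2.
have [b [d fb]] : poly_bounded f.
  rewrite /f /preprocess_bound.
  by repeat first [exact: poly_bounded_const | exact: poly_bounded_id
    | apply: poly_bounded_add | apply: poly_bounded_succ
    | apply: poly_bounded_mul | apply: poly_bounded_exp].
exists b, d => n Sigma l baseS _ ul lS.
set m := size l; set x := n + #|Sigma| + #|irr Sigma|.
have cS : #|Sigma| = m by rewrite -(eq_card lS); apply/card_uniqP.
pose Sigma' := [set p in reduction l].
have cS' : #|Sigma'| = m + 2 * (m * n).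
  by rewrite cardsE -size_reduction; apply/card_uniqP/uniq_reduction.
have irrS' :
    irr Sigma' = [set @proj n m.+1 @^-1: C | C : {set 'I_n} in irr Sigma].
  exact: irr_reduction.
have restrictK (C : {set 'I_n}) : restrict (@proj n m.+1 @^-1: C) = C.
  exact/preim_sec/lift_atK.
(* Equally many solutions: a bound in the output size of the new instance is one in that of the
   old. *)
have cirr : #|irr Sigma'| = #|irr Sigma|.
  by rewrite irrS' card_imset //; exact: can_inj restrictK.
have [|||y|T [sol [[s' exP s'0] usol solE TB]]] :=
  solve _ Sigma' (reduction l).
- exact: reduction_base.
- exact: degree_reduction.
- exact: uniq_reduction.
- by rewrite inE.
have szsol : size sol = #|irr Sigma|.
  by rewrite -cirr -(eq_card solE); apply/esym/card_uniqP.
have [T1 [s1 [ex1 TB1 fr1 [s11 s120]]]] :=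
  terminates_preprocess (s := update (fun=> Leaf) 0 (encode_input l))
   (erefl (encode_input l)) erefl erefl.
(* Preprocessing assigns no variable above 20, so the shifted program finds all its variables empty
   except its input, as [runs] demands. *)
have [z|s2 ex2 [s2E s2fr]] := exec_shift (k := 20) exP (s1 := s1).
  rewrite /update; case: eqP => [->|]; first by rewrite addn0.
  move=> z0; rewrite fr1 /update.
    by case: z z0.
  by case: z z0 => // z _.
have s21 : s2 1 = encode_unary n by rewrite s2fr.
have s220 : s2 20 = encode_output sol by rewrite -[20]addn0 s2E.
have [T3 [s3 [ex3 TB3 _ s30]]] := terminates_postprocess s21 s220.
exists (T1 + (T + T3).+1).+1, (rev (map (@restrict n m) sol)).
split.
- by exists s3 => //; exact: ExecSeq ex1 (ExecSeq ex2 ex3).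
(* Restriction need not be injective on arbitrary sets, but the solutions are preimages, on which
   [restrictK] inverts it. *)
- rewrite rev_uniq map_inj_in_uniq // => D E; rewrite !solE irrS'.
  by move=> /imsetP[C _ ->] /imsetP[C' _ ->]; rewrite !restrictK => ->.
- move=> C; rewrite mem_rev; apply/mapP/idP.
    by move=> [D]; rewrite solE irrS' => /imsetP[C' C'irr ->] ->; rewrite restrictK.
  move=> Cirr; exists (@proj n m.+1 @^-1: C); last by rewrite restrictK.
  by rewrite solE irrS' imset_f.
apply: leq_trans (fb x).
have nx : n <= x by rewrite /x; lia.
have mx : m <= x by rewrite /x; lia.
have rx : size sol <= x by rewrite /x; lia.
have b1 : preprocess_bound n m <= preprocess_bound x x.
  by rewrite /preprocess_bound !(leq_add, leq_mul).
have b2 : (m.+1 * n + #|Sigma'| + #|irr Sigma'|) ^ k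
   <= (x.+1 * x + (x + 2 * (x * x)) + x) ^ k.
  case: (k) => // k'; rewrite leq_exp2r // cS' cirr -szsol.
  by rewrite !(leq_add, leq_mul).
have b3 : size sol * (30 * n + 40) <= x * (30 * x + 40).
  by rewrite !(leq_add, leq_mul).
have {}TB := leq_trans TB (leq_add (leq_mul (leqnn a) b2) (leqnn a)).
have {}TB1 := leq_trans TB1 b1.
have {}TB3 := leq_trans TB3 (leq_add b3 (leqnn 20)).
rewrite /f addnS -addn2 leq_add2r -addnA.
by apply: leq_add TB1 _; apply: leq_add TB _.
Qed.
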